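(* Let $\boldsymbol{\ell} : \mathbb{N} \to \mathbb{N}_{\geq 5} \cup \{\infty\}$ and $\boldsymbol{c} : \mathbb{N} \to \mathbb{N} \cup \{\infty\}$ be non-decreasing functions. Let $d \in \mathbb{N}$ and $\alpha \in (0,\infty)$, let $U := U^{\alpha,\infty}_{\boldsymbol{\ell},\boldsymbol{c},\varrho_2}([0,1]^d)$ be the unit ball of the ReQU approximation space $A^{\alpha,\infty}_{\boldsymbol{\ell},\boldsymbol{c},\varrho_2}([0,1]^d)$, and let $\iota_\infty : A^{\alpha,\infty}_{\boldsymbol{\ell},\boldsymbol{c},\varrho_2}([0,1]^d) \hookrightarrow C([0,1]^d)$ be the embedding $u \mapsto u$. Then $$ err^{\mathrm{det}}(U, \iota_\infty) \leq \frac{64\,\alpha}{d\,(8\alpha + \gamma^\flat(\boldsymbol{\ell},\boldsymbol{c}))} \qquad\text{and}\qquad err^{\mathrm{MC}}(U, \iota_\infty) \leq \frac{64\,\alpha}{d\,(8\alpha + \gamma^\flat(\boldsymbol{\ell},\boldsymbol{c}))} , $$ where the right-hand side is read as $0$ if $\gamma^\flat(\boldsymbol{\ell},\boldsymbol{c}) = \infty$.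
   Context: $\mathbb{N} = \{1,2,3,\dots\}$. Neural networks. A neural network with $L$ layers is a sequence $\Phi = ((A_1,b_1),\dots,(A_L,b_L))$ with $A_j \in \mathbb{R}^{N_j \times N_{j-1}}$, $b_j \in \mathbb{R}^{N_j}$, $N_0,\dots,N_L \in \mathbb{N}$. Put $L(\Phi) = L$, $d_{\mathrm{in}}(\Phi) = N_0$, $d_{\mathrm{out}}(\Phi) = N_L$, $W(\Phi) = \sum_{j=1}^L (\|A_j\|_{\ell^0} + \|b_j\|_{\ell^0})$ where $\|\cdot\|_{\ell^0}$ counts nonzero entries, and $\|\Phi\|_{\mathcal{NN}} = \max_j \max\{\|A_j\|_\infty, \|b_j\|_\infty\}$ where $\|\cdot\|_\infty$ is the largest absolute value of an entry. The activation function is the ReQU $\varrho_2(x) = \max(0,x)^2$, applied componentwise to vectors, and the realization is $R_{\varrho_2}\Phi = T_L \circ (\varrho_2 \circ T_{L-1}) \circ \cdots \circ (\varrho_2 \circ T_1) : \mathbb{R}^{N_0} \to \mathbb{R}^{N_L}$ with $T_j x = A_j x + b_j$. For $n \in \mathbb{N}$, let $\Sigma_n^{\boldsymbol{\ell},\boldsymbol{c},\varrho_2}$ be the set of all $R_{\varrho_2}\Phi$ where $d_{\mathrm{in}}(\Phi) = d$, $d_{\mathrm{out}}(\Phi) = 1$, $W(\Phi) \leq n$, $L(\Phi) \leq \boldsymbol{\ell}(n)$, $\|\Phi\|_{\mathcal{NN}} \leq \boldsymbol{c}(n)$. With $\boldsymbol{\ell}^\ast := \sup_{n} \boldsymbol{\ell}(n)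 \in \mathbb{N} \cup \{\infty\}$ and $\mathbb{N}_{\leq \boldsymbol{\ell}^\ast} = \{L \in \mathbb{N} : L \leq \boldsymbol{\ell}^\ast\}$, $$\gamma^\flat(\boldsymbol{\ell},\boldsymbol{c}) := \sup\bigl\{\gamma \geq 0 : \exists L \in \mathbb{N}_{\leq \boldsymbol{\ell}^\ast},\, C > 0\ \forall n \in \mathbb{N}:\ n^\gamma \leq C\, \boldsymbol{c}(n)^{2^L - 1} \cdot n^{(2^L - 1)/2} \bigr\} \in [0,\infty].$$ Approximation space. For measurable $u : [0,1]^d \to \mathbb{R}$ let $$\Gamma(u) := \max\Bigl\{ \|u\|_{L^\infty([0,1]^d)},\ \sup_{n \in \mathbb{N}} \bigl[ n^\alpha \cdot \inf_{g \in \Sigma_n^{\boldsymbol{\ell},\boldsymbol{c},\varrho_2}} \|u - g\|_{L^\infty([0,1]^d)} \bigr] \Bigr\} \in [0,\infty],$$ $\|u\|_{A^{\alpha,\infty}_{\boldsymbol{\ell},\boldsymbol{c},\varrho_2}} := \inf\{t > 0 : \Gamma(u/t) \leq 1\}$, and let $A^{\alpha,\infty}_{\boldsymbol{\ell},\boldsymbol{c},\varrho_2}([0,1]^d)$ be the set of $u \in L^\infty([0,1]^d)$ for which this is finite. Its elements are (identified with) continuous functions on $[0,1]^d$. $U^{\alpha,\infty}_{\boldsymbol{\ell},\boldsymbol{c},\varrho_2}([0,1]^d)$ is the set of $u$ in this space with $\|u\|_{A^{\alpha,\infty}_{\boldsymbol{\ell},\boldsymbol{c},\varrho_2}} \leq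 1$, regarded as a subset of $C([0,1]^d)$, which carries the uniform norm. Optimal orders. Let $\varnothing \neq U \subset C([0,1]^d)$ be bounded, $Y$ a Banach space, $S : U \to Y$. $\mathrm{Alg}_m(U,Y)$ is the set of maps $A : U \to Y$ for which there exist $x_1,\dots,x_m \in [0,1]^d$ and a map $Q : \mathbb{R}^m \to Y$ with $A(u) = Q(u(x_1),\dots,u(x_m))$ for all $u \in U$. Put $e_m^{\mathrm{det}}(U,S) := \inf_{A \in \mathrm{Alg}_m(U,Y)} \sup_{u \in U} \|A(u) - S(u)\|_Y$ and $$err^{\mathrm{det}}(U,S) := \sup\{\beta \geq 0 : \exists C > 0\ \forall m \in \mathbb{N}:\ e_m^{\mathrm{det}}(U,S) \leq C\, m^{-\beta}\}.$$ $\mathrm{Alg}^{\mathrm{MC}}_m(U,Y)$ is the class of pairs $(\boldsymbol{A},\boldsymbol{m})$ where $\boldsymbol{A} = (A_\omega)_{\omega \in \Omega}$ is a family of maps $A_\omega : U \to Y$ indexed by a probability space $(\Omega,\mathcal{F},\mathbb{P})$ and $\boldsymbol{m} : \Omega \to \mathbb{N}$ is measurable with $\mathbb{E}[\boldsymbol{m}] \leq m$, such that $\omega \mapsto A_\omega(u)$ is measurable (Borel $\sigma$-algebra on $Y$) for each $u \in U$ and $A_\omega \in \mathrm{Alg}_{\boldsymbol{m}(\omega)}(U,Y)$ for each $\omega$. Put $e_m^{\mathrm{MC}}(U,S) := \inf_{(\boldsymbol{A},\boldsymbol{m}) \in \mathrm{Alg}^{\mathrm{MC}}_m(U,Y)}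 \sup_{u \in U} \mathbb{E}_\omega[\|S(u) - A_\omega(u)\|_Y]$ and $$err^{\mathrm{MC}}(U,S) := \sup\{\beta \geq 0 : \exists C > 0\ \forall m \in \mathbb{N}:\ e_m^{\mathrm{MC}}(U,S) \leq C\, m^{-\beta}\}.$$ Here $Y = C([0,1]^d)$ and $S = \iota_\infty$ restricted to $U$. *)

(* Defs.v *)
From HB Require Import structures.
From mathcomp Require Import all_boot all_order all_algebra.
From mathcomp Require Import all_classical all_reals all_analysis.
From mathcomp Require Import ring lra.

Set Implicit Arguments.
Unset Strict Implicit.
Unset Printing Implicit Defensive.

Import Order.TTheory GRing.Theory Num.Theory.
Import numFieldNormedType.Exports.

Local Open Scope classical_set_scope.
Local Open Scope ring_scope.

Definition unit_cube (R : realType) (d : nat) : set 'rV[R]_d :=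
  [set x | forall i, `[0, 1]%classic (x ord0 i)].
Arguments unit_cube : clear implicits.

(* [unit_cube R d] coerces to a type, which carries the topology induced by
   that of 'rV[R]_d. *)
Definition ccube_pred (R : realType) (d : nat) : pred (unit_cube R d -> R) :=
  [pred f | `[< continuous f >]].
Arguments ccube_pred : clear implicits.

Record ccube (R : realType) (d : nat) := CCube {
  ccube_fun :> unit_cube R d -> R;
  _ : ccube_fun \in ccube_pred R d
}.
Arguments ccube : clear implicits.

HB.instance Definition _ (R : realType) (d : nat) :=
  [isSub of ccube R d for @ccube_fun R d].
HB.instance Definition _ (R : realType) (d : nat) :=
  [Choice of ccube R d by <:].

Section ccube.
Context (R : realType) (d : nat).
Local Notation cube := (unit_cube R d).
Implicit Types f g : ccube R d.

Lemma ccube_cts f : continuous f.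
Proof. by case: f => f /= /asboolP. Qed.

Lemma ccube_submod : submod_closed (ccube_pred R d).
Proof.
split; first by apply/asboolP => x; exact: (@cst_continuous _ R 0).
move=> a f g /asboolP cf /asboolP cg; apply/asboolP => x.
by apply: (@continuousD _ _ _ (fun y => a * f y) g); [exact: cvgMl_tmp (cf x)|exact: cg].
Qed.

HB.instance Definition _ :=
  GRing.isSubmodClosed.Build _ _ (ccube_pred R d) ccube_submod.
HB.instance Definition _ := [SubChoice_isSubLmodule of ccube R d by <:].

Lemma ccubeD f g x : (f + g) x = f x + g x.
Proof. by []. Qed.

Lemma ccubeN f x : (- f) x = - f x.
Proof. by []. Qed.

Lemma ccubeZ (a : R) f x : (a *: f) x = a * f x.
Proof. by []. Qed.

Lemma ccubeP f g : f =1 g -> f = g.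
Proof. by move=> fg; apply/val_inj/funext. Qed.

Lemma unit_cube0 : 0 \in cube.
Proof. by rewrite inE => i; rewrite /= mxE in_itv/= lexx ler01. Qed.

Definition ccube_norm f : R := sup (range (fun x => `|f x|)).

Lemma ccube_has_sup f : has_sup (range (fun x => `|f x|)).
Proof.
split; first by exists `|f (exist _ 0 unit_cube0)|, (exist _ 0 unit_cube0).
have cK : compact cube.
  exact: (@rV_compact R d (fun=> `[0, 1]%classic) (fun=> @segment_compact R 0 1)).
have /subspace_valL_continuousP'-/(_ 0) cf := @ccube_cts f.
have /compact_bounded[M [_ /(_ (M + 1))]] := continuous_compact cf cK.
rewrite ltrDl ltr01 => /(_ isT) fM; exists (M + 1) => _ [x _ <-].
apply: fM; exists (val x); first exact: set_valP.
by have /(congr1 (@^~ x)) := valLK (0 : R) (ccube_fun f).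
Qed.

Lemma ccube_norm_ge f x : `|f x| <= ccube_norm f.
Proof.
by apply: ub_le_sup; [case: (ccube_has_sup f)|exists x].
Qed.

Lemma ccube_norm_le f (M : R) : (forall x, `|f x| <= M) -> ccube_norm f <= M.
Proof.
move=> fM; apply: ge_sup; first by case: (ccube_has_sup f).
by move=> _ [x _ <-].
Qed.

Lemma ccube_normD f g : ccube_norm (f + g) <= ccube_norm f + ccube_norm g.
Proof.
apply: ccube_norm_le => x; rewrite ccubeD (le_trans (ler_normD _ _))//.
by rewrite lerD// ccube_norm_ge.
Qed.

Lemma ccube_normZ (a : R) f : ccube_norm (a *: f) = `|a| * ccube_norm f.
Proof.
have le (b : R) h : ccube_norm (b *: h) <= `|b| * ccube_norm h.
  by apply: ccube_norm_le => x; rewrite ccubeZ normrM ler_wpM2l// ccube_norm_ge.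
apply/eqP; rewrite eq_le le/=.
have [->|a0] := eqVneq a 0.
  rewrite normr0 mul0r; apply: le_trans (ccube_norm_ge _ (exist _ 0 unit_cube0)).
  exact: normr_ge0.
rewrite -ler_pdivlMl ?normr_gt0// -normfV.
by apply: le_trans (le _ _); rewrite scalerA mulVf// scale1r.
Qed.

Lemma ccube_norm0_eq0 f : ccube_norm f = 0 -> f = 0.
Proof.
move=> f0; apply: ccubeP => x; apply/eqP; rewrite -normr_le0 -f0.
exact: ccube_norm_ge.
Qed.

HB.instance Definition _ := Lmodule_isNormed.Build R (ccube R d)
  ccube_normD ccube_normZ ccube_norm0_eq0.

Lemma ccube_normE f : `|f| = sup (range (fun x => `|f x|)).
Proof. by []. Qed.

Lemma ccube_complete (F : set_system (ccube R d)) :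
  ProperFilter F -> cauchy F -> cvg F.
Proof.
move=> FF Fc.
have evc x : cvg ((fun f : ccube R d => f x) @ F).
  apply: cauchy_cvg; apply/cauchyP => e e0.
  have /cauchyP /(_ _ e0)[h hF] := Fc.
  exists (h x); rewrite /fmap/=; apply: filterS hF => f.
  rewrite -!ball_normE /ball_/= => hf; apply: le_lt_trans hf.
  exact: (ccube_norm_ge (h - f)).
pose g x := lim ((fun f : ccube R d => f x) @ F).
have unif (e : R) : 0 < e -> \forall f \near F, forall x, `|g x - (f : ccube R d) x| <= e.
  move=> e0; have e20 : 0 < e / 2 by rewrite divr_gt0.
  have /cauchyP /(_ _ e20)[h hF] := Fc.
  near=> f => x.
  have hf : ball h (e / 2) f by near: f.
  apply/ler_addgt0Pr => r r0.
  have /cvgrPdist_lt /(_ _ r0) gxF := evc x.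
  near F => k.
  have gk : `|g x - k x| < r by near: k.
  have hk : ball h (e / 2) k by near: k.
  move: hf hk; rewrite -!ball_normE /ball_/= => hf hk.
  have hfx := le_lt_trans (ccube_norm_ge (h - f) x) hf.
  have hkx := le_lt_trans (ccube_norm_ge (h - k) x) hk.
  rewrite (_ : g x - f x = (g x - k x) - (h x - k x) + (h x - f x)); last ring.
  rewrite (le_trans (ler_normD _ _))// [e]splitr [_ + r]addrAC.
  rewrite lerD ?(ltW hfx)// (le_trans (ler_normB _ _))// addrC lerD ?ltW//.
have gcts : continuous g.
  move=> x; apply/(@cvgrPdist_le _ R^o _ _ (nbhs_filter x)) => e e0.
  have e30 : 0 < e / 3 by rewrite divr_gt0.
  near F => f.
  have gf : forall x, `|g x - f x| <= e / 3 by near: f; exact: unif.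
  have /(@cvgrPdist_le _ R^o _ _ (nbhs_filter x))/(_ _ e30) fx := @ccube_cts f x.
  near=> y; have fxy : `|f x - f y| <= e / 3 by near: y.
  rewrite (_ : g x - g y = (g x - f x) + (f x - f y) - (g y - f y)); last ring.
  rewrite (le_trans (ler_normB _ _))// (_ : e = e / 3 + e / 3 + e / 3); last lra.
  by rewrite lerD// (le_trans (ler_normD _ _))// lerD.
have gP : g \in ccube_pred R d by apply/asboolP.
apply/cvg_ex; exists (CCube gP); apply/cvgrPdist_le => e e0.
near=> f; apply: ccube_norm_le => x; move: x.
by near: f; exact: unif.
Unshelve. all: by end_near. Qed.

HB.instance Definition _ := Uniform_isComplete.Build (ccube R d) ccube_complete.

End ccube.

Section cube_measure.
Context (R : realType).
Local Notation mR := (measurableTypeR R).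

Definition cons_pair (d : nat) (p : mR * d.-tuple mR) : d.+1.-tuple mR :=
  [the d.+1.-tuple mR of p.1 :: p.2].

Lemma measurable_cons_pair d : measurable_fun setT (@cons_pair d).
Proof. exact: measurable_cons. Qed.

HB.instance Definition _ d :=
  @isMeasurableFun.Build _ _ _ _ (@cons_pair d) (@measurable_cons_pair d).

(* The Lebesgue measure restricted to [0,1]^d, built as the d-fold product of
   the Lebesgue measure restricted to [0,1] (that is, of the uniform
   distribution on [0,1]). *)
Fixpoint cube_measure (d : nat) : probability (d.-tuple mR) R :=
  match d with
  | 0 => \d_([tuple] : 0.-tuple mR)
  | d'.+1 =>
      distribution (uniform_prob (@ltr01 R) \x cube_measure d')%E
        (@cons_pair d')
  end.

End cube_measure.

(* [u] is extended by 0 outside of the cube, which [cube_measure] neglects. *)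
Definition Linfty_norm (R : realType) (d : nat) (u : unit_cube R d -> R) :
    \bar R :=
  ('N[cube_measure R d]_(+oo)
    [(fun t : d.-tuple (measurableTypeR R) =>
       ('valL_0 u (\row_(i < d) tnth t i))%:E)])%E.

(* [network R n0 n] is the type of the networks with input dimension [n0] and
   output dimension [n]; the dimension of the output of each layer is of the
   form [k.+1] because it is positive. *)
Inductive network (R : realType) (n0 : nat) : nat -> Type :=
| FirstLayer k of 'M[R]_(k.+1, n0) & 'cV[R]_k.+1 : network R n0 k.+1
| AddLayer m k of network R n0 m & 'M[R]_(k.+1, m) & 'cV[R]_k.+1 :
    network R n0 k.+1.

Section network.
Context (R : realType) (n0 : nat).

Definition requ (x : R) : R := Num.max 0 x ^+ 2.

Definition mx_l0 m n (A : 'M[R]_(m, n)) : nat :=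
  #|[pred ij : 'I_m * 'I_n | A ij.1 ij.2 != 0]|.

Fixpoint depth n (Phi : network R n0 n) : nat :=
  match Phi with
  | FirstLayer _ _ _ => 1
  | AddLayer _ _ Psi _ _ => (depth Psi).+1
  end.

Fixpoint nb_weights n (Phi : network R n0 n) : nat :=
  match Phi with
  | FirstLayer _ A b => (mx_l0 A + mx_l0 b)%N
  | AddLayer _ _ Psi A b => (nb_weights Psi + (mx_l0 A + mx_l0 b))%N
  end.

(* The library's norm on matrices is the largest absolute value of an entry. *)
Fixpoint nn_norm n (Phi : network R n0 n) : R :=
  match Phi with
  | FirstLayer _ A b => Num.max `|A| `|b|
  | AddLayer _ _ Psi A b => Num.max (nn_norm Psi) (Num.max `|A| `|b|)
  end.

Fixpoint realization n (Phi : network R n0 n) (x : 'cV[R]_n0) : 'cV[R]_n :=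
  match Phi with
  | FirstLayer _ A b => A *m x + b
  | AddLayer _ _ Psi A b => A *m map_mx requ (realization Psi x) + b
  end.

End network.

(* N u {oo} is represented by [option nat], with [None] for oo. *)
Definition ereal_of_onat (R : realType) (k : option nat) : \bar R :=
  if k is Some k' then k'%:R%:E else +oo%E.
Arguments ereal_of_onat : clear implicits.

Section approximation_space.
Context (R : realType) (d : nat) (ell c : nat -> option nat).
Local Open Scope ereal_scope.

Definition Sigma_nn (n : nat) : set ('rV[R]_d -> R) :=
  [set g | exists Phi : network R d 1,
    [/\ (nb_weights Phi <= n)%N,
        (depth Phi)%:R%:E <= ereal_of_onat R (ell n),
        (nn_norm Phi)%:E <= ereal_of_onat R (c n) &
        g = (fun x => realization Phi x^T ord0 ord0)]].

Definition Gamma (alpha : R) (u : unit_cube R d -> R) : \bar R :=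
  maxe (Linfty_norm u)
    (ereal_sup [set (n%:R `^ alpha)%:E *
        ereal_inf [set Linfty_norm (fun x => u x - g (val x))%R
                  | g in Sigma_nn n]
      | n in [set n : nat | (0 < n)%N]]).

Definition approx_norm (alpha : R) (u : unit_cube R d -> R) : \bar R :=
  ereal_inf [set t%:E | t in
    [set t : R | (0 < t)%R /\ Gamma alpha (fun x => u x / t)%R <= 1]].

(* The elements of the approximation space, which are classes of measurable
   functions, are identified with their continuous representatives. *)
Definition approx_space (alpha : R) : set (ccube R d) :=
  [set u | approx_norm alpha u < +oo].

Definition approx_ball (alpha : R) : set (ccube R d) :=
  [set u | approx_space alpha u /\ approx_norm alpha u <= 1].

Definition ell_sup : \bar R :=
  ereal_sup [set ereal_of_onat R (ell n) | n in [set n : nat | (0 < n)%N]].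

Definition gamma_flat : \bar R :=
  ereal_sup [set gamma%:E | gamma in
    [set gamma : R | (0 <= gamma)%R /\
      exists L : nat, [/\ (0 < L)%N, L%:R%:E <= ell_sup &
        exists2 C : R, (0 < C)%R & forall n : nat, (0 < n)%N ->
          (n%:R `^ gamma)%:E <=
            C%:E * ereal_of_onat R (c n) ^+ (2 ^ L - 1)%N
            * (n%:R `^ ((2 ^ L - 1)%N%:R / 2))%:E]]].

End approximation_space.

Section optimal_order.
Context (R : realType) (d : nat) (Y : completeNormedModType R).
(* A map defined on [U] is represented by a map on C([0,1]^d), of which only
   the restriction to [U] matters. *)
Context (U : set (ccube R d)) (S : ccube R d -> Y).
Local Open Scope ereal_scope.

Definition Alg (m : nat) : set (ccube R d -> Y) :=
  [set A | exists (x : 'I_m -> unit_cube R d) (Q : ('I_m -> R) -> Y),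
    forall u, U u -> A u = Q (fun i => u (x i))].

Definition e_det (m : nat) : \bar R :=
  ereal_inf [set ereal_sup [set `|A u - S u|%:E | u in U] | A in Alg m].

Definition Alg_MC dW (W : measurableType dW) (P : probability W R) (m : nat)
    (A : W -> ccube R d -> Y) (mm : W -> nat) : Prop :=
  [/\ measurable_fun setT mm /\ (forall w, (0 < mm w)%N),
      'E_P[fun w => (mm w)%:R%R] <= m%:R%:E,
      forall u, U u -> measurable_fun setT
        (fun w => A w u : g_sigma_algebraType (@open Y)) &
      forall w, Alg (mm w) (A w)].

Definition e_MC (m : nat) : \bar R :=
  ereal_inf [set e | exists dW (W : measurableType dW) (P : probability W R)
      (A : W -> ccube R d -> Y) (mm : W -> nat),
    Alg_MC P m A mm /\
    e = ereal_sup [set 'E_P[fun w => `|S u - A w u|%R] | u in U]].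

Definition optimal_order (e : nat -> \bar R) : \bar R :=
  ereal_sup [set beta%:E | beta in [set beta : R | (0 <= beta)%R /\
    exists2 C : R, (0 < C)%R & forall m : nat, (0 < m)%N ->
      e m <= (C * m%:R `^ (- beta))%:E]].

Definition err_det : \bar R := optimal_order e_det.
Definition err_MC : \bar R := optimal_order e_MC.

End optimal_order.

(* Main.v *)
(* A network of depth k + 4 with n weights of size at most M realizes a bump
   requ (eta - sum_i (y_i - y_0)^2), where y_i = a (x_i - t_i + 1)^(2^(k+1)) and
   y_0 = a are obtained by repeated squaring: each layer carries N ~ sqrt n copies
   of its channels, and summing them with the weight M gives the amplification
   a = (M N)^(2^(k+1) - 1).  This bump has height eta^2 and is supported where
   |x_i - t_i| < sqrt eta / a for all i.  For eta = n^(-alpha/2) it lies, up to sign,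
   in the unit ball: it is small compared with the approximation rate required
   for fewer than n weights, and exactly representable with n weights.

   Placing such bumps on a grid, samples at m points miss most of them and cannot
   tell a missed bump from its negative, so that the (average) error is of order
   n^(-alpha) as long as m is at most a small multiple of
   (a n^(alpha/4))^d.  The choice k + 5 = max(L, 5) makes a^64 at least of order
   n^gamma for every gamma admissible for L in the definition of gamma_flat. *)
Require Import Defs.
From HB Require Import structures.
From mathcomp Require Import all_boot all_order all_algebra.
From mathcomp Require Import all_classical all_reals all_analysis.
From mathcomp Require Import ess_sup_inf measurable_realfun zify ring lra.

Set Implicit Arguments.
Unset Strict Implicit.
Unset Printing Implicit Defensive.

Import Order.TTheory GRing.Theory Num.Theory.
Import numFieldNormedType.Exports.

Local Open Scope classical_set_scope.
Local Open Scope ring_scope.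

(** * Membership in the unit ball of the approximation space *)

Lemma Linfty_norm_le (R : realType) (d : nat) (u : unit_cube R d -> R) (M : R) :
  0 <= M -> (forall x, `|u x| <= M) -> (Linfty_norm u <= M%:E)%E.
Proof.
move=> M0 uM; rewrite /Linfty_norm unlock; case: ifPn => [_|_]; last by rewrite lee_fin.
apply/ess_supP/aeW => t; rewrite /= lee_fin.
by rewrite /valL_ /=; case: ('oinv_set_val _) => [x|] //=; rewrite normr0.
Qed.

Section approx_ball_membership.
Context (R : realType) (d : nat) (ell c : nat -> option nat).
Hypothesis hell : forall n, (0 < n)%N -> (5%:R%:E <= ereal_of_onat R (ell n))%E.
Hypothesis hc : forall n, (0 < n)%N -> (1 <= ereal_of_onat R (c n))%E.
Hypothesis ell_ndecr : forall m n, (0 < m)%N -> (m <= n)%N ->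
  (ereal_of_onat R (ell m) <= ereal_of_onat R (ell n))%E.
Hypothesis c_ndecr : forall m n, (0 < m)%N -> (m <= n)%N ->
  (ereal_of_onat R (c m) <= ereal_of_onat R (c n))%E.

Lemma Sigma_nn0 n : (0 < n)%N -> Sigma_nn ell c n (fun _ : 'rV[R]_d => 0).
Proof.
move=> n0; exists (FirstLayer (0 : 'M[R]_(1, d)) 0); split => /=.
- by rewrite /mx_l0 !eq_card0// => ij; rewrite inE /= mxE eqxx.
- by apply: le_trans (hell n0); rewrite lee_fin ler_nat.
- by rewrite !normr0 maxxx; apply: le_trans (hc n0); rewrite lee_fin.
- by apply/funext => x; rewrite mul0mx addr0 mxE.
Qed.

Lemma Sigma_nnW m n : (0 < m)%N -> (m <= n)%N ->
  @Sigma_nn R d ell c m `<=` Sigma_nn ell c n.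
Proof.
move=> m0 mn _ [Phi [W L N ->]]; exists Phi; split => //.
- exact: leq_trans mn.
- exact: le_trans L (ell_ndecr _ _).
- exact: le_trans N (c_ndecr _ _).
Qed.

(** For budgets k below [n], approximation by 0 costs at most n^(-alpha), which the factor k^alpha
    cannot lift above 1. From [n] on, [g] itself is admissible and the error vanishes. *)
Lemma approx_ball_Sigma_nn (alpha : R) n (u : ccube R d) (g : 'rV[R]_d -> R) :
  0 < alpha -> (0 < n)%N -> Sigma_nn ell c n g -> (forall x, u x = g (val x)) ->
  (forall x, `|u x| <= n%:R `^ (- alpha)) -> approx_ball ell c alpha u.
Proof.
move=> alpha0 n0 gS ug uh.
have n1 : 1 <= n%:R :> R by rewrite ler1n.
have h0 : 0 <= n%:R `^ (- alpha) :> R by exact: powR_ge0.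
suff G1 : (Gamma ell c alpha (fun x => u x / 1)%R <= 1)%E.
  have u1 : (approx_norm ell c alpha u <= 1)%E.
    by apply: ereal_inf_lbound; exists 1.
  by split => //; apply: le_lt_trans u1 _; rewrite ltry.
rewrite (_ : (fun x => _) = u); last by apply/funext => x; rewrite divr1.
rewrite /Gamma ge_max; apply/andP; split.
  apply: le_trans (Linfty_norm_le h0 uh) _; rewrite lee_fin powRN invf_le1 ?powR_gt0 ?ltr0n//.
  by have := ge0_ler_powR (ltW alpha0) _ _ n1; rewrite powR1 !nnegrE; apply.
apply: ge_ereal_sup => _ [k /= k0 <-].
have kpos : (0 <= (k%:R `^ alpha)%:E :> \bar R)%E by rewrite lee_fin powR_ge0.
have [kn|nk] := ltnP k n.
  apply: (@le_trans _ _ ((k%:R `^ alpha)%:E * (n%:R `^ (- alpha))%:E)%E).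
    apply: lee_wpmul2l => //.
    apply: (@le_trans _ _ (Linfty_norm (fun x => u x - 0))).
      by apply: ereal_inf_lbound; exists (fun=> 0) => //; exact: Sigma_nn0.
    by apply: Linfty_norm_le => // x; rewrite subr0.
  rewrite -EFinM lee_fin powRN ler_pdivrMr ?powR_gt0 ?ltr0n// mul1r.
  by rewrite ge0_ler_powR ?nnegrE ?ler_nat ?(ltW alpha0)// ltnW.
apply: (@le_trans _ _ ((k%:R `^ alpha)%:E * 0)%E); last by rewrite mule0 lee_fin.
apply: lee_wpmul2l => //.
apply: (@le_trans _ _ (Linfty_norm (fun x => u x - g (val x)))).
  by apply: ereal_inf_lbound; exists g => //; exact: Sigma_nnW gS.
by apply: Linfty_norm_le => // x; rewrite ug subrr normr0.
Qed.

End approx_ball_membership.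

(** * Lower bounds for sampling algorithms from disjoint bumps *)

Section lower_bound.
Context (R : realType) (d : nat).

(** This makes the error of a randomized algorithm a legitimate integrand: open rays generate the
    Borel sets of the line, and the continuous map z -> |y - z| pulls them back to open sets. *)
Lemma measurable_norm_sub (Y : completeNormedModType R) dW (W : measurableType dW)
    (A : W -> Y) (y : Y) :
  measurable_fun setT (A : W -> g_sigma_algebraType (@open Y)) ->
  measurable_fun setT (fun w => `|y - A w|).
Proof.
move=> mA; apply: (measurability _ (RGenOInfty.measurableE R)) => // _ [_ [a ->] <-].
rewrite setTI [X in measurable X](_ : _ = A @^-1` [set z | a < `|y - z|]); last first.
  by apply/seteqP; split => w /=; rewrite in_itv/= andbT.
rewrite -[X in measurable X]setTI; apply: mA => //; apply: sub_sigma_algebra.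
rewrite (_ : [set z | _] = (fun z => `|y - z|) @^-1` [set r | a < r])//.
apply: open_comp; last exact: open_gt.
move=> z _; apply: (@continuous_comp _ _ _ (fun z => y - z) Num.Def.normr).
  by apply: continuousB; [exact: cst_continuous|exact: id].
exact: norm_continuous.
Qed.

Section alg_lower_bound.
Context (Y : completeNormedModType R) (U : set (ccube R d)) (S : ccube R d -> Y).

(** A deterministic algorithm is a randomized one over a one-point space; [0 < m] is there because
    the sample counts in [Alg_MC] are positive. *)
Lemma e_MC_le_e_det m : (0 < m)%N -> (e_MC U S m <= e_det U S m)%E.
Proof.
move=> m0; apply: le_ereal_inf_tmp => _ [A AA <-].
apply: ereal_inf_lbound.
pose P : probability unit R := \d_tt.
exists _, unit, P, (fun=> A), (fun=> m); split.
  split => //.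
  - by rewrite expectation_cst.
congr ereal_sup; apply/seteqP; split => _ [u Uu <-]; exists u => //.
  by rewrite expectation_cst distrC.
by rewrite expectation_cst distrC.
Qed.

Lemma err_det_le_err_MC : (err_det U S <= err_MC U S)%E.
Proof.
apply: ge_ereal_sup => _ [b [b0 [C C0 bC]] <-]; apply: ereal_sup_ubound.
exists b => //; split => //; exists C => // m m0.
exact: le_trans (e_MC_le_e_det m0) (bC _ m0).
Qed.

End alg_lower_bound.

Section disjoint_bumps.
Context (U : set (ccube R d)) (I : finType) (f : I -> ccube R d) (h : R).
Hypothesis fU : forall i, U (f i).
Hypothesis fNU : forall i, U (- f i).
Hypothesis fdisj : forall i j x, f i x != 0 -> f j x != 0 -> i = j.
Hypothesis fh : forall i, h <= `|f i|.
Hypothesis h0 : 0 <= h.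

(* At most [k] of the bumps are seen by the [k] sample points; on each of the
   others, [A] returns the same output for [f i] and [- f i]. *)
Lemma Alg_sum_dist_ge k (A : ccube R d -> ccube R d) : Alg U k A ->
  2 * h * #|I|%:R <=
    \sum_i (`|f i - A (f i)| + `|- f i - A (- f i)|) + 2 * h * k%:R.
Proof.
move=> [x [Q AQ]].
pose hit i := [exists j, f i (x j) != 0].
have hits : \sum_i (hit i : nat)%:R <= k%:R :> R.
  apply: (@le_trans _ _ (\sum_i \sum_(j < k) ((f i (x j) != 0) : nat)%:R)).
    apply: ler_sum => i _; rewrite /hit; case: existsP => [[j fj]|_] /=.
      rewrite (bigD1 j)//= fj lerDl; exact: sumr_ge0.
    exact: sumr_ge0.
  (* After exchanging the sums, disjointness of the supports leaves at most one bump per sample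
     point. *)
  rewrite exchange_big/= -[k in leRHS]card_ord -sum1_card natr_sum ler_sum// => j _.
  have [i fi|f0] := pickP (fun i => f i (x j) != 0).
    rewrite (bigD1 i)//= fi big1 ?addr0// => i' i'i.
    case: (boolP (f i' (x j) != 0)) => // fi'.
    by rewrite (fdisj fi' fi) eqxx in i'i.
  by rewrite big1// => i _; rewrite f0.
apply: (@le_trans _ _ (\sum_i (`|f i - A (f i)| + `|- f i - A (- f i)|)
    + 2 * h * \sum_i (hit i : nat)%:R)); last first.
  by rewrite lerD2l ler_wpM2l// mulr_ge0.
rewrite mulr_sumr -big_split/= -sum1_card natr_sum mulr_sumr ler_sum// => i _.
rewrite mulr1; case: (boolP (hit i)) => hi.
  by rewrite mulr1 lerDr addr_ge0.
rewrite mulr0 addr0.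
have f0 j : f i (x j) = 0.
  by apply: contraNeq hi => fj; apply/existsP; exists j.
have AN : A (- f i) = A (f i).
  rewrite !AQ//; congr Q; apply/funext => j.
  by rewrite ccubeN f0 oppr0.
have -> : `|- f i - A (- f i)| = `|f i + A (f i)|.
  by rewrite AN -opprD normrN.
(* The common output cancels, leaving the norm of [2 f i]. *)
apply: (@le_trans _ _ `|(f i - A (f i)) + (f i + A (f i))|); last exact: ler_normD.
by rewrite addrACA addNr addr0 -mulr2n normrMn mulr_natl ler_wMn2r.
Qed.

(** Averaging over the bumps and both signs: the bound of [Alg_sum_dist_ge] is affine in the number
    of samples, so after integration only the bound [m] on the mean of [mm] enters, and each of the
    [2 * #|I|] expected errors is at most the worst one. *)
Lemma e_MC_ge m : (0 < #|I|)%N ->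
  ((h * (1 - m%:R / #|I|%:R))%:E <= e_MC U (idfun : ccube R d -> ccube R d) m)%E.
Proof.
move=> I0; apply: le_ereal_inf_tmp => _ [dW [W [P [A [mm [[[mmm _] mmE mA Am] ->]]]]]].
set E := [set _ | _ in _]; set s := ereal_sup E.
have Es g : U g -> ('E_P[fun w => `|g - A w g|%R] <= s)%E.
  by move=> Ug; apply: ereal_sup_ubound; exists g.
have mg g : U g -> measurable_fun setT (fun w => `|g - A w g|).
  by move=> Ug; apply: measurable_norm_sub; exact: mA.
have s0 : (0 <= s)%E.
  case/card_gt0P : I0 => i _; apply: le_trans (Es _ (fU i)).
  by apply: expectation_ge0.
have mmR : measurable_fun setT (fun w => (mm w)%:R : R).
  by apply: (@measurableT_comp _ _ _ _ _ _ (fun k : nat => k%:R : R)).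
move: s0 Es; case: s => [s| |]// _ Es; last by rewrite leey.
have : ((2 * h * #|I|%:R)%:E <= (2 * #|I|%:R * s)%:E + (2 * h * m%:R)%:E)%E.
  rewrite -[leLHS](@expectation_cst _ _ _ P).
  pose D w := \sum_i (`|f i - A w (f i)| + `|- f i - A w (- f i)|).
  have mD i : measurable_fun setT (fun w => `|f i - A w (f i)| + `|- f i - A w (- f i)|).
    by apply: measurable_funD; exact: mg.
  have -> : (2 * h * m%:R)%:E = ((2 * h)%:E * m%:R%:E)%E by [].
  apply: (@le_trans _ _ (\int[P]_w (D w + 2 * h * (mm w)%:R)%:E)%E).
    rewrite unlock; apply: ge0_le_integral => //.
    - by move=> w _; rewrite lee_fin !mulr_ge0.
    - exact/measurable_EFinP/measurable_cst.
    - apply/measurable_EFinP; apply: measurable_funD; first exact: measurable_sum.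
      exact: measurable_funM.
    - by move=> w _; rewrite lee_fin; exact: Alg_sum_dist_ge (Am w).
  under eq_integral do rewrite EFinD EFinM.
  have D0 w : 0 <= D w by rewrite sumr_ge0// => i _; rewrite addr_ge0.
  have h20 : 0 <= 2 * h by rewrite mulr_ge0.
  rewrite ge0_integralD//; last 4 first.
  - by move=> w _; rewrite lee_fin.
  - by apply/measurable_EFinP; exact: measurable_sum.
  - by move=> w _; rewrite mule_ge0.
  - by apply/measurable_EFinP; exact: measurable_funM.
  rewrite ge0_integralZl_EFin//; last by apply/measurable_EFinP.
  apply: leeD; last by rewrite lee_wpmul2l// ; move: mmE; rewrite unlock.
  under eq_integral do rewrite -sumEFin.
  rewrite ge0_integral_sum//; last first.
    by move=> i; apply/measurable_EFinP.
  apply: (@le_trans _ _ (\sum_(i : I) (s + s)%:E)%E).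
    apply: lee_sum => i _; under eq_integral do rewrite EFinD.
    rewrite ge0_integralD//; last 2 first.
    - by apply/measurable_EFinP; exact: mg.
    - by apply/measurable_EFinP; exact: mg.
    rewrite EFinD; apply: leeD.
      by have := Es _ (fU i); rewrite unlock.
    by have := Es _ (fNU i); rewrite unlock.
  by rewrite sumEFin lee_fin sumr_const -mulr2n -mulrnA -[leLHS]mulr_natl natrM.
rewrite -EFinD !lee_fin => H.
have I0' : 0 < #|I|%:R :> R by rewrite ltr0n.
rewrite mulrBr mulr1 mulrA lerBlDr -(ler_pM2r (x := 2 * #|I|%:R)) ?mulr_gt0//.
rewrite mulrA [h * 2]mulrC.
suff -> : (s + h * m%:R / #|I|%:R) * (2 * #|I|%:R) = 2 * #|I|%:R * s + 2 * h * m%:R by [].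
by field; rewrite gt_eqF.
Qed.
End disjoint_bumps.
End lower_bound.

(** * The network realizing a bump *)

Section matrix_bounds.
Context (R : realType).

Lemma mx_norm_le m n (A : 'M[R]_(m, n)) (M : R) :
  0 <= M -> (forall i j, `|A i j| <= M) -> `|A| <= M.
Proof.
move=> M0 AM; rewrite /Num.Def.normr/= mx_normrE.
by apply/bigmax_leP; split => // ij _; exact: AM.
Qed.

Lemma mx_l0_le m n (A : 'M[R]_(m, n)) : (mx_l0 A <= m * n)%N.
Proof. by rewrite (leq_trans (max_card _))// card_prod !card_ord. Qed.

End matrix_bounds.

Section bump_network.
Context (R : realType) (d p : nat) (c : R) (t : 'I_d.+1 -> R).
Hypothesis c1 : 1 <= c.
Hypothesis t01 : forall i, 0 <= t i <= 1.

(* The layers of width [width.+1 = (d + 2) * (p + 1)] hold [p + 1] copies of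
   each of the [d + 1] coordinates, and of a constant, indexed by [ord0]. *)
Definition width := (p + d.+1 * p.+1)%N.

(** The vectorization bijection of matrices splits a channel index into a block and a copy number;
    it applies because [width.+1] is convertible to [d.+2 * p.+1]. *)
Definition coord (j : 'I_width.+1) : 'I_d.+2 :=
  (enum_val (cast_ord (esym (mxvec_cast d.+2 p.+1)) j)).1.

(** Every block has [p.+1] copies; this factor is the gain contributed by the width. *)
Lemma sum_coord (F : 'I_d.+2 -> R) :
  \sum_j F (coord j) = p.+1%:R * \sum_i F i.
Proof.
rewrite (reindex (cast_ord (mxvec_cast d.+2 p.+1) \o enum_rank)); last first.
  apply: onW_bij; apply: bij_comp; last exact: enum_rank_bij.
  by exists (cast_ord (esym (mxvec_cast d.+2 p.+1))) => j; rewrite ?cast_ordK ?cast_ordKV.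
under eq_bigr do rewrite /coord /= cast_ordK enum_rankK.
rewrite -(pair_bigA _ (fun i _ => F i))/= mulr_sumr; apply: eq_bigr => i _.
by rewrite sumr_const card_ord mulr_natl.
Qed.

(** The shift by 1 keeps all channels nonnegative on the cube, where ReQU is therefore plain
    squaring. *)
Definition shifted (x : 'I_d.+1 -> R) (k : 'I_d.+2) : R :=
  if unlift ord0 k is Some i then x i - t i + 1 else 1.

Definition first_net : network R d.+1 width.+1 :=
  FirstLayer (\matrix_(j, i) (coord j == lift ord0 i)%:R)
    (\col_j (if unlift ord0 (coord j) is Some i then 1 - t i else 1)).

Fixpoint power_net k : network R d.+1 width.+1 :=
  if k is k'.+1 then
    AddLayer (power_net k') (\matrix_(j, j') (c * (coord j == coord j')%:R)) 0
  else first_net.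

(** Solution of a_0 = 1, a_(k+1) = c (p + 1) a_k^2: each layer squares the amplitude, then gains [c]
    from the weight and [p.+1] from summing the copies. *)
Definition ampl k : R := (c * p.+1%:R) ^+ (2 ^ k - 1).

Lemma ampl0 : ampl 0 = 1.
Proof. by []. Qed.

Lemma amplS k : ampl k.+1 = c * p.+1%:R * ampl k ^+ 2.
Proof.
rewrite /ampl -exprM -exprS expnS; congr (_ ^+ _).
have : (0 < 2 ^ k)%N by rewrite expn_gt0.
by move: (2 ^ k)%N => n; lia.
Qed.

Lemma requ_ge0 (x : R) : 0 <= x -> requ x = x ^+ 2.
Proof. by move=> x0; rewrite /requ max_r. Qed.

Lemma requDN (x : R) : requ x + requ (- x) = x ^+ 2.
Proof.
have [x0|x0] := leP 0 x.
  by rewrite requ_ge0// /requ max_l ?oppr_le0// expr0n addr0.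
by rewrite /requ max_l 1?ltW// max_r ?oppr_ge0 1?ltW// expr0n add0r sqrrN.
Qed.

Lemma power_netE k (x : 'cV[R]_d.+1) j :
  (forall i, 0 <= x i ord0) ->
  realization (power_net k) x j ord0 =
    ampl k * shifted (x ^~ ord0) (coord j) ^+ (2 ^ k).
Proof.
move=> x0; have v0 i : 0 <= shifted (x ^~ ord0) i.
  rewrite /shifted; case: unliftP => // l _.
  by rewrite -addrA addr_ge0// addrC subr_ge0; case/andP : (t01 l).
elim: k j => [|k IH] j.
  rewrite /= !mxE ampl0 mul1r expr1 /shifted; case: unliftP => [i ji|j0].
    rewrite (bigD1 i)//= mxE ji eqxx mul1r big1 ?addr0; first by ring.
    move=> l li; rewrite mxE ji (inj_eq lift_inj) eq_sym.
    by rewrite (negbTE li) mul0r.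
  rewrite big1 ?add0r// => i _; rewrite mxE j0.
  by rewrite (negbTE (neq_lift _ _)) mul0r.
rewrite /= !mxE addr0.
(* The summand depends on the channel only through its block, so that [sum_coord] applies. *)
pose F i := c * (coord j == i)%:R * (ampl k * shifted (x ^~ ord0) i ^+ (2 ^ k)) ^+ 2.
rewrite (eq_bigr (fun j' => F (coord j'))); last first.
  move=> j' _; rewrite !mxE IH requ_ge0//.
  by rewrite mulr_ge0// exprn_ge0// mulr_ge0// (le_trans ler01).
rewrite sum_coord /F.
rewrite (bigD1 (coord j))//= eqxx mulr1 big1 ?addr0; last first.
  by move=> i ij; rewrite eq_sym (negbTE ij) mulr0 mul0r.
by rewrite amplS expnSr exprM; ring.
Qed.

Definition diff_mx : 'M[R]_(d.+1, width.+1) :=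
  \matrix_(i, j) (c * ((coord j == lift ord0 i)%:R - (coord j == ord0)%:R)).

(* [eta - \sum_i (y_i - y_0) ^ 2], where [y_0] is the amplified constant; the
   squares are obtained from [requ z + requ (- z) = z ^ 2]. *)
Definition bump_net k (eta sgn : R) : network R d.+1 1 :=
  @AddLayer _ _ _ 0 (@AddLayer _ _ _ 0
    (@AddLayer _ _ _ (d + d.+1) (power_net k) (col_mx diff_mx (- diff_mx)) 0)
    (const_mx (-1)) (const_mx eta)) (const_mx sgn) 0.

Definition requ_bump k (eta : R) (x : 'I_d.+1 -> R) : R :=
  requ (eta - \sum_i (ampl k.+1 * ((x i - t i + 1) ^+ (2 ^ k.+1) - 1)) ^+ 2).

(** The layer of [diff_mx] squares once more before subtracting the constant block from block i,
    whence [ampl k.+1] instead of [ampl k]. *)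
Lemma diff_mxE k (x : 'cV[R]_d.+1) i : (forall i, 0 <= x i ord0) ->
  (diff_mx *m map_mx (@requ R) (realization (power_net k) x)) i ord0 =
    ampl k.+1 * ((x i ord0 - t i + 1) ^+ (2 ^ k.+1) - 1).
Proof.
move=> x0; have c0 : 0 <= c by exact: le_trans ler01 c1.
have v0 j : 0 <= shifted (x ^~ ord0) j.
  rewrite /shifted; case: unliftP => // l _.
  by rewrite -addrA addr_ge0// addrC subr_ge0; case/andP : (t01 l).
pose F l := c * ((l == lift ord0 i)%:R - (l == ord0)%:R) *
  (ampl k * shifted (x ^~ ord0) l ^+ (2 ^ k)) ^+ 2.
rewrite mxE (eq_bigr (fun j' => F (coord j'))); last first.
  move=> j' _; rewrite !mxE power_netE// requ_ge0//.
  by rewrite mulr_ge0// exprn_ge0// mulr_ge0.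
rewrite sum_coord /F (bigD1 ord0)//= (bigD1 (lift ord0 i))//= big1 ?addr0; last first.
  by move=> l /andP[l0 li]; rewrite (negbTE l0) (negbTE li) subrr mulr0 mul0r.
rewrite eqxx /shifted unlift_none liftK expr1n.
by rewrite amplS expnSr exprM /=; ring.
Qed.

Lemma bump_netE k eta sgn (x : 'cV[R]_d.+1) : (forall i, 0 <= x i ord0) ->
  realization (bump_net k eta sgn) x ord0 ord0 = sgn * requ_bump k eta (x ^~ ord0).
Proof.
move=> x0; rewrite /= !mxE big_ord1 !mxE addr0; congr (_ * requ _).
rewrite addrC; congr (_ + _).
rewrite addr0; set z := map_mx _ (realization _ _).
transitivity (\sum_(j < d.+1 + d.+1)
    - requ (col_mx (diff_mx *m z) (- (diff_mx *m z)) j ord0)).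
  apply: eq_bigr => j _; rewrite [const_mx _ _ _]mxE [map_mx _ _ _ _]mxE mulN1r -mulNmx.
  by rewrite -(mul_col_mx diff_mx (- diff_mx) z).
rewrite big_split_ord /= -big_split -sumrN /=; apply: eq_bigr => i _.
by rewrite col_mxEu col_mxEd -opprD [fun_of_matrix (- _) _ _]mxE requDN diff_mxE.
Qed.

Lemma nn_norm_bump_net k eta sgn : 0 <= eta <= 1 -> `|sgn| = 1 ->
  nn_norm (bump_net k eta sgn) <= c.
Proof.
move=> /andP[eta0 eta1] s1; have c0 : 0 <= c by exact: le_trans ler01 c1.
have D i j : `|diff_mx i j| <= c.
  rewrite mxE normrM ger0_norm// ler_piMr//.
  case: (coord j == lift ord0 i); case: (coord j == ord0).
  - by rewrite subrr normr0.
  - by rewrite subr0 normr1.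
  - by rewrite sub0r normrN normr1.
  - by rewrite subrr normr0.
rewrite /= !ge_max !normr0 c0 /= !andbT -!andbA; apply/and4P; split.
- elim: k => [|k IH] /=; rewrite ge_max.
    apply/andP; split; apply: mx_norm_le => // i j; rewrite mxE.
      by rewrite normr_nat (le_trans _ c1)// lern1 leq_b1.
    case: unliftP => [l _|_]; last by rewrite normr1.
    have /andP[t0 t1] := t01 l; rewrite ger0_norm ?subr_ge0//.
    by apply: le_trans c1; rewrite lerBlDr lerDl.
  rewrite IH ge_max normr0 c0 andbT; apply: mx_norm_le => // i j; rewrite mxE.
  by rewrite normrM ger0_norm// ler_piMr// normr_nat lern1 leq_b1.
- apply: mx_norm_le => // i j; rewrite mxE.
  by case: fintype.split => l //; rewrite mxE normrN.
- by apply: mx_norm_le => // i j; rewrite mxE normrN normr1.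
apply/andP; split; apply: mx_norm_le => // i j; rewrite mxE.
  by rewrite ger0_norm// (le_trans eta1).
by rewrite s1.
Qed.

Lemma depth_bump_net k eta sgn : depth (bump_net k eta sgn) = (k + 4)%N.
Proof. by rewrite /= !addnS addn0; elim: k => //= k ->. Qed.

(** All entries are counted as nonzero: with W = (d + 2) (p + 1), each of the k + 4 layers has at
    most 8 W^2 of them. *)
Lemma nb_weights_bump_net k eta sgn :
  (nb_weights (bump_net k eta sgn) <=
     (k + 4) * (8 * (d.+2 ^ 2)) * p.+1 ^ 2)%N.
Proof.
clear c1 t01.
have widthE : width.+1 = (d.+2 * p.+1)%N by [].
have Wd : (d.+2 <= width.+1)%N by rewrite widthE leq_pmulr.
have power_le : (nb_weights (power_net k) <= (k + 1) * (2 * width.+1 ^ 2))%N.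
  elim: k => [|k IH].
    rewrite /=; apply: leq_trans (leq_add (mx_l0_le _) (mx_l0_le _)) _.
    by move: Wd; set W := width.+1; nia.
  rewrite /=; apply: leq_trans (leq_add IH (leq_add (mx_l0_le _) (mx_l0_le _))) _.
  by set W := width.+1; nia.
rewrite /=.
apply: leq_trans (leq_add (leq_add (leq_add power_le
  (leq_add (mx_l0_le _) (mx_l0_le _))) (leq_add (mx_l0_le _) (mx_l0_le _)))
  (leq_add (mx_l0_le _) (mx_l0_le _))) _.
rewrite -mulnA -[(8 * _ * _)%N]mulnA -expnMn -widthE.
by move: Wd; set W := width.+1; nia.
Qed.

End bump_network.

(** * Height, support and continuity of a bump *)

Section bump_function.
Context (R : realType) (d p : nat) (c : R) (t : 'I_d.+1 -> R).
Hypothesis c1 : 1 <= c.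
Hypothesis t01 : forall i, 0 <= t i <= 1.

Lemma requ_le (x y : R) : x <= y -> requ x <= requ y.
Proof.
move=> xy; have m0 (z : R) : 0 <= Num.max 0 z by rewrite le_max lexx.
rewrite /requ lerXn2r ?nnegrE//.
by rewrite ge_max !le_max lexx xy orbT.
Qed.

Lemma bump_ge0 k eta (x : 'I_d.+1 -> R) : 0 <= requ_bump p c t k eta x.
Proof. exact: sqr_ge0. Qed.

Lemma bump_le k eta (x : 'I_d.+1 -> R) : 0 <= eta -> requ_bump p c t k eta x <= eta ^+ 2.
Proof.
move=> eta0; rewrite -(requ_ge0 eta0); apply: requ_le.
by rewrite gerBl sumr_ge0// => i _; exact: sqr_ge0.
Qed.

Lemma bump_center k eta : 0 <= eta -> requ_bump p c t k eta t = eta ^+ 2.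
Proof.
move=> eta0; rewrite /requ_bump big1 ?subr0 ?requ_ge0// => i _.
by rewrite subrr add0r expr1n subrr mulr0 expr0n.
Qed.

(* For [v >= 0] and [q > 0], [v ^ q - 1] is at least as far from 0 as [v - 1]. *)
Lemma bump_support k eta (x : 'I_d.+1 -> R) i : (forall i, 0 <= x i) ->
  requ_bump p c t k eta x != 0 -> (ampl p c k.+1 * (x i - t i)) ^+ 2 < eta.
Proof.
move=> x0; apply: contraNT; rewrite -leNgt => le_eta.
rewrite /requ_bump /requ max_l ?expr0n//= subr_le0 (le_trans le_eta)//.
rewrite (bigD1 i)//= (le_trans (y := (ampl p c k.+1 * ((x i - t i + 1) ^+ (2 ^ k.+1) - 1)) ^+ 2))//.
  rewrite !exprMn ler_wpM2l ?sqr_ge0// -real_normK ?num_real//.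
  rewrite -[leRHS]real_normK ?num_real// lerXn2r ?nnegrE//.
  set v := x i - t i + 1; have v0 : 0 <= v.
    by rewrite /v -addrA addr_ge0// addrC subr_ge0; case/andP : (t01 i).
  rewrite (_ : x i - t i = v - 1); last by rewrite /v addrK.
  (* The cofactor 1 + v + ... + v^(q-1) of v - 1 is at least its first term 1, since v is
     nonnegative. *)
  rewrite subrX1 normrM ler_peMr// ger0_norm; last first.
    by rewrite sumr_ge0// => j _; rewrite exprn_ge0.
  have [q ->] : exists q, (2 ^ k.+1)%N = q.+1.
    by exists (2 ^ k.+1).-1; rewrite prednK// expn_gt0.
  by rewrite big_ord_recl expr0 lerDl sumr_ge0// => j _; rewrite exprn_ge0.
by rewrite lerDl sumr_ge0// => j _; exact: sqr_ge0.
Qed.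

Lemma bump_continuous k eta :
  continuous (fun x : unit_cube R d.+1 => requ_bump p c t k eta (val x ord0)).
Proof.
have cX (f : unit_cube R d.+1 -> R) n : continuous f -> continuous (fun x => f x ^+ n).
  move=> cf x; apply: (@continuous_comp _ _ _ f (fun y => y ^+ n)); first exact: cf.
  exact: exprn_continuous.
rewrite /requ_bump /requ; apply: (cX _ 2).
have cx i : continuous (fun x : unit_cube R d.+1 => val x ord0 i).
  have cv : continuous (fun x : unit_cube R d.+1 => val x) by exact: initial_continuous.
  move=> x; have := continuous_comp (cv x)
    (@coord_continuous _ _ _ ord0 i (val x : 'rV[R]_d.+1)).
  exact.
pose s (x : unit_cube R d.+1) :=
  \sum_i (ampl p c k.+1 * ((val x ord0 i - t i + 1) ^+ (2 ^ k.+1) - 1)) ^+ 2.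
suff cs : continuous s.
  move=> x; apply: (@continuous_max _ _ (cst 0) (fun x => eta - s x)).
    exact: cst_continuous.
  apply: (@continuousB _ R^o _ (cst eta) s); [exact: cst_continuous|exact: cs].
apply: (@continuous_big R^o); first exact: add_continuous.
move=> i _.
have c1' : continuous (fun x : unit_cube R d.+1 => val x ord0 i - t i).
  by move=> x; apply: (@continuousB _ R^o _ _ (cst (t i))); [exact: cx|exact: cst_continuous].
have c2 : continuous (fun x : unit_cube R d.+1 => val x ord0 i - t i + 1).
  by move=> x; apply: (@continuousD _ R^o _
    (fun x : unit_cube R d.+1 => val x ord0 i - t i) (cst 1)); [exact: c1'|exact: cst_continuous].
have c3 : continuous (fun x : unit_cube R d.+1 => (val x ord0 i - t i + 1) ^+ (2 ^ k.+1) - 1).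
  move=> x; apply: (@continuousB _ R^o _
    (fun x : unit_cube R d.+1 => (val x ord0 i - t i + 1) ^+ (2 ^ k.+1)) (cst 1));
    last exact: cst_continuous.
  exact: (cX _ _ c2).
have c4 : continuous (fun x : unit_cube R d.+1 =>
    ampl p c k.+1 * ((val x ord0 i - t i + 1) ^+ (2 ^ k.+1) - 1)).
  by move=> x; exact: cvgMl_tmp (c3 x).
exact: (cX _ _ c4).
Qed.

End bump_function.

(** * A grid of bumps in the unit ball *)

Section bump_family.
Context (R : realType) (d : nat) (ell c : nat -> option nat).
Hypothesis hell : forall n, (0 < n)%N -> (5%:R%:E <= ereal_of_onat R (ell n))%E.
Hypothesis hc : forall n, (0 < n)%N -> (1 <= ereal_of_onat R (c n))%E.
Hypothesis ell_ndecr : forall m n, (0 < m)%N -> (m <= n)%N ->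
  (ereal_of_onat R (ell m) <= ereal_of_onat R (ell n))%E.
Hypothesis c_ndecr : forall m n, (0 < m)%N -> (m <= n)%N ->
  (ereal_of_onat R (c m) <= ereal_of_onat R (c n))%E.
Context (k p n G : nat) (alpha M : R).
Hypothesis alpha0 : 0 < alpha.
Hypothesis n0 : (0 < n)%N.
Hypothesis G0 : (0 < G)%N.
Hypothesis M1 : 1 <= M.
Hypothesis Mc : (M%:E <= ereal_of_onat R (c n))%E.
Hypothesis k_ell : ((k + 4)%:R%:E <= ereal_of_onat R (ell n))%E.
Hypothesis weights_le : ((k + 4) * (8 * d.+2 ^ 2) * p.+1 ^ 2 <= n)%N.

Let eta : R := n%:R `^ (- (alpha / 2)).

(** The radius sqrt eta / a of a bump is at most half the mesh size 1 / G. *)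
Hypothesis G_le : 4 * G%:R ^+ 2 * eta <= ampl p M k.+1 ^+ 2.

Lemma eta_ge0 : 0 <= eta.
Proof. exact: powR_ge0. Qed.

Lemma eta_sqr : eta ^+ 2 = n%:R `^ (- alpha).
Proof.
by rewrite /eta -powR_mulrn ?powR_ge0// -powRrM; congr (_ `^ _); field.
Qed.

Lemma eta_le1 : eta <= 1.
Proof.
rewrite /eta powRN invf_le1 ?powR_gt0 ?ltr0n//.
have n1 : 1 <= n%:R :> R by rewrite ler1n.
have a2 : 0 <= alpha / 2 by rewrite divr_ge0// ltW.
by have := ge0_ler_powR a2 _ _ n1; rewrite powR1 !nnegrE; apply.
Qed.

Definition center (g : {ffun 'I_d.+1 -> 'I_G}) (i : 'I_d.+1) : R :=
  ((g i)%:R + 1 / 2) / G%:R.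

Lemma center01 g i : 0 <= center g i <= 1.
Proof.
rewrite /center divr_ge0 ?addr_ge0 ?divr_ge0//= ler_pdivrMr ?ltr0n// mul1r.
have : (g i).+1%:R <= G%:R :> R by rewrite ler_nat.
by rewrite -natr1; lra.
Qed.

Definition grid_bump g : ccube R d.+1 :=
  CCube (introT (asboolP _) (@bump_continuous R d p M (center g) k eta)).

Lemma grid_bumpE g x : grid_bump g x = requ_bump p M (center g) k eta (val x ord0).
Proof. by []. Qed.

Lemma cube_ge0 (x : unit_cube R d.+1) i : 0 <= val x ord0 i.
Proof. by have := set_valP x i; rewrite /= in_itv/= => /andP[]. Qed.

(** By [G_le], the bump of [g] is nonzero only where g_i < G x_i < g_i + 1 for all i, and these open
    cells are disjoint. *)
Lemma grid_bump_disjoint g h x : grid_bump g x != 0 -> grid_bump h x != 0 -> g = h.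
Proof.
have close f : grid_bump f x != 0 ->
    forall i, `|2 * (G%:R * val x ord0 i) - (2 * (f i)%:R + 1)| < 1.
  move=> fx i; rewrite -(@ltr_pXn2r _ 2)// ?nnegrE// expr1n real_normK ?num_real//.
  have fx1 := bump_support (center01 f) i (cube_ge0 x) fx.
  have G40 : 0 < 4 * G%:R ^+ 2 :> R by rewrite mulr_gt0 ?exprn_gt0 ?ltr0n.
  rewrite -(ltr_pM2l G40) in fx1; have {fx1} := lt_le_trans fx1 G_le.
  have a0 : 0 < ampl p M k.+1.
    by apply: exprn_gt0; apply: mulr_gt0 => //; exact: lt_le_trans M1.
  rewrite exprMn mulrCA gtr_pMr; last by exact: (exprn_gt0 _ a0).
  rewrite /center.
  set y := val x ord0 i; set r := G%:R; have r0 : r != 0 by rewrite pnatr_eq0 -lt0n.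
  suff -> : 4 * r ^+ 2 * (y - ((f i)%:R + 1 / 2) / r) ^+ 2 =
    (2 * (r * y) - (2 * (f i)%:R + 1)) ^+ 2 by [].
  by field.
move=> /close gx /close hx; apply/ffunP => i; apply/val_inj/eqP => /=.
have := gx i; have := hx i; move: (val x ord0 i) => y.
rewrite !ltr_norml => /andP[h1 h2] /andP[g1 g2].
have : (g i)%:R < (h i).+1%:R :> R by rewrite -natr1; lra.
have : (h i)%:R < (g i).+1%:R :> R by rewrite -natr1; lra.
by rewrite !ltr_nat !ltnS eqn_leq => -> ->.
Qed.

Lemma grid_bump_norm_ge g : n%:R `^ (- alpha) <= `|grid_bump g|.
Proof.
have tC : unit_cube R d.+1 (\row_i center g i).
  by move=> i; rewrite /= mxE in_itv/= center01.
pose x : unit_cube R d.+1 := exist _ (\row_i center g i) (mem_set tC).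
apply: (@le_trans _ _ `|grid_bump g x|); last exact: ccube_norm_ge.
rewrite grid_bumpE /= (_ : _ ord0 = center g); last by apply/funext => i; rewrite mxE.
by rewrite bump_center ?eta_ge0// eta_sqr ger0_norm ?powR_ge0.
Qed.

(** The sign is the weight of the output layer, so a bump and its negative obey the same network
    bounds. *)
Lemma grid_bump_approx_ball g (sgn : R) : `|sgn| = 1 ->
  approx_ball ell c alpha (sgn *: grid_bump g).
Proof.
move=> s1; pose Phi := bump_net p M (center g) k eta sgn.
apply: (approx_ball_Sigma_nn hell hc ell_ndecr c_ndecr alpha0 n0
    (g := fun x => realization Phi x^T ord0 ord0)).
- exists Phi; split => //.
  + exact: leq_trans (nb_weights_bump_net _ _ _ _ _ _) weights_le.
  + by rewrite depth_bump_net.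
  + by apply: le_trans Mc; rewrite lee_fin nn_norm_bump_net ?eta_ge0 ?eta_le1//;
      exact: center01.
- move=> x; rewrite ccubeZ grid_bumpE bump_netE//; last 2 first.
  + exact: center01.
  + by move=> i; rewrite mxE cube_ge0.
  by congr (_ * requ_bump _ _ _ _ _ _); apply/funext => i; rewrite mxE.
move=> x; rewrite ccubeZ normrM s1 mul1r grid_bumpE ger0_norm ?bump_ge0//.
by rewrite -eta_sqr bump_le// eta_ge0.
Qed.

Lemma e_MC_approx_ball_ge m :
  ((n%:R `^ (- alpha) * (1 - m%:R / (G ^ d.+1)%N%:R))%:E <=
    e_MC (approx_ball ell c alpha) (idfun : ccube R d.+1 -> ccube R d.+1) m)%E.
Proof.
have <- : #|{: {ffun 'I_d.+1 -> 'I_G}}| = (G ^ d.+1)%N by rewrite card_ffun !card_ord.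
apply: (e_MC_ge (f := grid_bump)).
- by move=> g; rewrite -[grid_bump g]scale1r; apply: grid_bump_approx_ball; rewrite normr1.
- by move=> g; rewrite -scaleN1r; apply: grid_bump_approx_ball; rewrite normrN1.
- exact: grid_bump_disjoint.
- exact: grid_bump_norm_ge.
- exact: powR_ge0.
- by rewrite card_ffun !card_ord expn_gt0 G0.
Qed.

End bump_family.

(** * From error bounds to exponents *)

Section asymptotics.
Context (R : realType).

(** The logarithm is unbounded; this extracts an inequality between exponents from one between
    logarithms. *)
Lemma mul_ln_bounded_le0 (x B : R) (N0 : nat) :
  (forall N, (N0 <= N)%N -> x * ln N%:R <= B) -> x <= 0.
Proof.
move=> H; rewrite leNgt; apply/negP => x0.
pose N := maxn N0 (Num.truncn (expR (B / x))).+1.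
have := H N (leq_maxl _ _); apply/negP; rewrite -ltNge mulrC -ltr_pdivrMr//.
rewrite -[ltLHS]expRK ltr_ln ?posrE ?expR_gt0//; last first.
  by rewrite ltr0n (leq_trans _ (leq_maxr _ _)).
apply: lt_le_trans (truncnS_gt _) _.
by rewrite ler_nat leq_maxr.
Qed.

(** Network weights are finite even where [cn] is infinite. In that case M = max(1, x / C) suffices:
    the exponent being positive, a single factor M already gives C M >= x, and the other factors are
    at least 1. *)
Lemma finite_weight_bound (cn : option nat) (q : nat) (C x y : R) :
  0 < C -> 1 <= y -> (1 <= ereal_of_onat R cn)%E ->
  (x%:E <= C%:E * ereal_of_onat R cn ^+ q.+1 * y%:E)%E ->
  exists M : R, [/\ 1 <= M, (M%:E <= ereal_of_onat R cn)%E & x <= C * M ^+ q.+1 * y].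
Proof.
move=> C0 y1; case: cn => [k|] /=.
  by rewrite lee_fin => k1 H; exists k%:R; split => //; rewrite -lee_fin !EFinM EFin_expe.
move=> _ _; exists (Num.max 1 (x / C)); split; first by rewrite le_max lexx.
  exact: leey.
set M := Num.max _ _; have M1 : 1 <= M by rewrite le_max lexx.
apply: (@le_trans _ _ (C * M)).
  by rewrite -ler_pdivrMl// mulrC le_max lexx orbT.
rewrite -[leLHS]mulr1 ler_pM// ?mulr_ge0 ?(ltW C0) ?(le_trans ler01 M1)//.
by rewrite ler_pM2l// exprS ler_peMr ?(le_trans ler01 M1)// exprn_ege1.
Qed.

(** If no value reached the integer [L], all of them, and hence their supremum, would be at most L -
    1. *)
Lemma ell_sup_attained (ell : nat -> option nat) (L : nat) : (0 < L)%N ->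
  (L%:R%:E <= ell_sup R ell)%E ->
  exists2 n, (0 < n)%N & (L%:R%:E <= ereal_of_onat R (ell n))%E.
Proof.
move=> L0 H; apply: contrapT => /forall2NP Hn.
suff : (ell_sup R ell <= L.-1%:R%:E)%E.
  move=> /(le_trans H); rewrite lee_fin ler_nat; by case: L L0 {H Hn} => // L _; rewrite ltnn.
apply: ge_ereal_sup => _ [n /= n0 <-]; have [//|] := Hn n.
case: (ell n) => [l|] /=; last by rewrite leey.
by rewrite !lee_fin !ler_nat => /negP; rewrite -ltnNge; case: L L0 {H Hn}.
Qed.

End asymptotics.

Section rate.
Context (R : realType) (d : nat) (alpha : R) (ell c : nat -> option nat).
Hypothesis hell : forall n, (0 < n)%N -> (5%:R%:E <= ereal_of_onat R (ell n))%E.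
Hypothesis hc : forall n, (0 < n)%N -> (1 <= ereal_of_onat R (c n))%E.
Hypothesis ell_ndecr : forall m n, (0 < m)%N -> (m <= n)%N ->
  (ereal_of_onat R (ell m) <= ereal_of_onat R (ell n))%E.
Hypothesis c_ndecr : forall m n, (0 < m)%N -> (m <= n)%N ->
  (ereal_of_onat R (c m) <= ereal_of_onat R (c n))%E.
Hypothesis alpha0 : 0 < alpha.

Local Notation U := (approx_ball ell c alpha : set (ccube R d.+1)).

(* The logarithmic form of: [Q ~ ampl p M k.+1 * n ^ (alpha / 4)] disjoint bumps
   of height [n ^ - alpha] fit along each axis, so that [m = Q ^ (d + 1)] samples
   leave an error of order [n ^ - alpha]. *)
Lemma e_MC_scale_bound (k p n : nat) (M beta C : R) :
  (0 < n)%N -> 1 <= M -> (M%:E <= ereal_of_onat R (c n))%E ->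
  ((k + 4)%:R%:E <= ereal_of_onat R (ell n))%E ->
  ((k + 4) * (8 * d.+2 ^ 2) * p.+1 ^ 2 <= n)%N -> (8 <= p.+1)%N ->
  0 <= beta -> 0 < C ->
  (forall m, (0 < m)%N ->
    (e_MC U (idfun : ccube R d.+1 -> ccube R d.+1) m <= (C * m%:R `^ (- beta))%:E)%E) ->
  beta * d.+1%:R * (ln (ampl p M k.+1) + alpha / 4 * ln n%:R - ln 16) <=
    alpha * ln n%:R + ln 2 + ln C.
Proof.
move=> n0 M1 Mc kl wn p8 beta0 C0 eC.
(* For G = 4 Q the condition 4 G^2 eta <= a^2 reads Q <= X. *)
set a := ampl p M k.+1; set X := a * n%:R `^ (alpha / 4) / 8.
have nR0 : 0 < n%:R :> R by rewrite ltr0n.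
have n4 : 1 <= n%:R `^ (alpha / 4) :> R.
  have n1 : 1 <= n%:R :> R by rewrite ler1n.
  have a4 : 0 <= alpha / 4 by rewrite divr_ge0// ltW.
  by have := ge0_ler_powR a4 _ _ n1; rewrite powR1 !nnegrE; apply.
(* The assumption [8 <= p.+1] serves to make X >= 1, hence Q positive. *)
have Mp8 : 8 <= M * p.+1%:R.
  by rewrite -[leLHS]mul1r ler_pM// ler_nat.
have a8 : 8 <= a.
  apply: (le_trans Mp8); rewrite /a /ampl.
  have -> : (2 ^ k.+1 - 1)%N = (2 ^ k.+1 - 2).+1.
    by have := leq_pexp2l (isT : 0 < 2)%N (ltn0Sn k); lia.
  by rewrite exprS ler_peMr ?(le_trans _ Mp8)// exprn_ege1// (le_trans _ Mp8)// ler1n.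
have a0 : 0 < a by exact: lt_le_trans a8.
have X1 : 1 <= X.
  by rewrite /X ler_pdivlMr// mul1r -[leLHS]mulr1 ler_pM.
pose Q := Num.truncn X.
have Q0 : (0 < Q)%N by rewrite truncn_gt0.
have QX : Q%:R <= X by rewrite truncn_le// (le_trans ler01).
have XQ : X <= 2 * Q%:R.
  apply: (le_trans (ltW (truncnS_gt _))); rewrite -/Q -natr1.
  have : 1 <= Q%:R :> R by rewrite ler1n.
  by lra.
pose m := (Q ^ d.+1)%N; have m0 : (0 < m)%N by rewrite expn_gt0 Q0.
(* With a grid four times finer than Q, the [m] samples see at most a fraction 4^-(d+1) <= 1/2 of
   the bumps. *)
have G0 : (0 < 4 * Q)%N by rewrite muln_gt0.
have G_le : 4 * (4 * Q)%N%:R ^+ 2 * n%:R `^ (- (alpha / 2)) <= a ^+ 2.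
  rewrite powRN ler_pdivrMr ?powR_gt0//.
  have -> : n%:R `^ (alpha / 2) = (n%:R `^ (alpha / 4)) ^+ 2 :> R.
    by rewrite -powR_mulrn ?powR_ge0// -powRrM; congr (_ `^ _); field.
  have -> : 4 * (4 * Q)%N%:R ^+ 2 = (8 * Q%:R) ^+ 2 :> R by rewrite natrM; ring.
  rewrite -exprMn lerXn2r ?nnegrE// ?mulr_ge0 ?powR_ge0 ?(ltW a0)//.
  by move: QX; rewrite /X ler_pdivlMr// mulrC.
have := e_MC_approx_ball_ge hell hc ell_ndecr c_ndecr alpha0 n0 G0 M1 Mc kl wn G_le m.
move=> /le_trans/(_ (eC _ m0)); rewrite lee_fin => H.
have mG : 1 / 2 <= 1 - m%:R / ((4 * Q) ^ d.+1)%N%:R :> R.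
  have q0 : 0 < (Q ^ d.+1)%N%:R :> R by rewrite ltr0n.
  rewrite /m expnMn natrM invfM mulrCA divff ?gt_eqF// mulr1.
  have : (4 ^ d.+1)%N%:R^-1 <= 2^-1 :> R.
    rewrite lef_pV2 ?posrE ?ltr0n ?expn_gt0// ler_nat expnS.
    by rewrite (leq_trans (_ : 2 <= 4)%N)// leq_pmulr// expn_gt0.
  by lra.
have {}H : n%:R `^ (- alpha) * (1 / 2) <= C * m%:R `^ (- beta).
  by apply: le_trans H; rewrite ler_wpM2l ?powR_ge0.
have Qpos : 0 < Q%:R :> R by rewrite ltr0n.
have mR0 : 0 < m%:R :> R by rewrite ltr0n.
have lnH : - (alpha * ln n%:R) - ln 2 <= ln C - beta * (d.+1%:R * ln Q%:R).
  have : ln (n%:R `^ (- alpha) * (1 / 2)) <= ln (C * m%:R `^ (- beta)).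
    by rewrite ler_ln// posrE mulr_gt0// ?powR_gt0.
  rewrite !lnM ?posrE ?powR_gt0// !ln_powR !mulNr ln1 add0r lnV ?posrE//.
  by rewrite /m natrX lnXn// mulr_natl.
(* Here 16 is the 8 in X times the 2 lost in rounding X down to Q. *)
have lnQ : ln a + alpha / 4 * ln n%:R - ln 16 <= ln Q%:R.
  have : ln X <= ln (2 * Q%:R).
    by rewrite ler_ln// posrE ?mulr_gt0// (lt_le_trans ltr01).
  have -> : ln 16 = ln 8 + ln 2 :> R by rewrite -lnM ?posrE//; congr ln; ring.
  rewrite /X !lnM ?posrE ?mulr_gt0 ?powR_gt0 ?invr_gt0// lnV ?posrE// ln_powR.
  by lra.
have : beta * d.+1%:R * (ln a + alpha / 4 * ln n%:R - ln 16) <= beta * d.+1%:R * ln Q%:R.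
  by rewrite ler_wpM2l// mulr_ge0.
by move: lnH; rewrite mulrA; lra.
Qed.

(** Along the budgets n = K N^2, both the error bound and the growth condition on [c] become affine
    in ln N; letting N grow compares the coefficients. *)
Lemma rate_le (beta C gamma C' : R) (L : nat) :
  0 <= beta -> 0 < C ->
  (forall m, (0 < m)%N ->
    (e_MC U (idfun : ccube R d.+1 -> ccube R d.+1) m <= (C * m%:R `^ (- beta))%:E)%E) ->
  0 <= gamma -> (0 < L)%N -> (L%:R%:E <= ell_sup R ell)%E -> 0 < C' ->
  (forall n, (0 < n)%N -> ((n%:R `^ gamma)%:E <=
     C'%:E * ereal_of_onat R (c n) ^+ (2 ^ L - 1)%N
       * (n%:R `^ ((2 ^ L - 1)%N%:R / 2))%:E)%E) ->
  beta * d.+1%:R * (8 * alpha + gamma) <= 64 * alpha.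
Proof.
move=> beta0 C0 eC gamma0 L0 Lell C'0 gC.
(* Origin of 64: with u = 2^L and v = 2^k, the exponent 2^L - 1 is at most 64 times the exponent
   2^(k+1) - 1 of [ampl]. *)
have arith (u v : nat) : (0 < v -> u <= v * 32 -> u - 1 <= 64 * (2 * v - 1))%N by lia.
(* Truncated subtraction: the depth k + 4 is 4 if L <= 5, within the general bound on [ell], and L -
   1 otherwise, which [ell] reaches at some [n1]. *)
pose k := (L - 5)%N; have Lk : (L <= k + 5)%N by rewrite /k; lia.
have [n1 n10 kn1] : exists2 n1, (0 < n1)%N & ((k + 4)%:R%:E <= ereal_of_onat R (ell n1))%E.
  have [L5|L5] := leqP L 5.
    exists 1%N => //; apply: le_trans (hell _) => //; rewrite lee_fin ler_nat /k; lia.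
  have [n1 n10 Ln1] := ell_sup_attained L0 Lell; exists n1 => //.
  by apply: le_trans Ln1; rewrite lee_fin ler_nat /k; lia.
pose K := ((k + 4) * (8 * d.+2 ^ 2))%N.
have K0 : (0 < K)%N by rewrite /K !muln_gt0 addn_gt0 orbT.
set D := beta * d.+1%:R; have D0 : 0 <= D by rewrite mulr_ge0.
(* This is the coefficient of ln N; multiplied by 32, it yields the claim even with 16 alpha for 8
   alpha. *)
suff : D * (gamma / 32 + alpha / 2) - 2 * alpha <= 0.
  have : 0 <= D * alpha by rewrite mulr_ge0// ltW.
  by lra.
apply: (@mul_ln_bounded_le0 _ _ (D * (ln C' / 64 + ln 16) + alpha * ln K%:R + ln 2 + ln C)
  (maxn 8 n1)).
move=> [|p]; first by rewrite leqn0 -leqn0 geq_max.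
rewrite geq_max => /andP[p8 pn1].
have N2 : (0 < p.+1 ^ 2)%N by rewrite expn_gt0.
have NR1 : 1 <= p.+1%:R :> R by rewrite ler1n.
pose q := (2 ^ L - 2)%N.
have qE : (2 ^ L - 1)%N = q.+1.
  by have := leq_pexp2l (isT : 0 < 2)%N L0; rewrite /q; lia.
(* The growth condition is taken at N^2 instead of K N^2, so that its last factor is exactly N^(2^L
   - 1); monotonicity of [c] carries the weight M over to [n]. *)
have := gC _ N2; rewrite qE => /finite_weight_bound -/(_ C'0).
have -> : (p.+1 ^ 2)%N%:R `^ (q.+1%:R / 2) = p.+1%:R ^+ q.+1 :> R.
  rewrite natrX -[(_ ^+ 2)]powR_mulrn// -powRrM -powR_mulrn//.
  by congr (_ `^ _); field.
move=> /(_ (exprn_ege1 _ NR1) (hc N2)) [M [M1 Mc gM]].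
pose n := (K * p.+1 ^ 2)%N.
have pn : (p.+1 ^ 2 <= n)%N by rewrite leq_pmull.
have n0 : (0 < n)%N by exact: leq_trans pn.
have n1n : (n1 <= n)%N.
  by apply: leq_trans pn1 (leq_trans _ pn); rewrite expnS expn1 leq_pmulr.
have Mcn := le_trans Mc (c_ndecr N2 pn).
have kn := le_trans kn1 (ell_ndecr n10 n1n).
have := e_MC_scale_bound n0 M1 Mcn kn (leqnn _) p8 beta0 C0 eC.
rewrite -/D.
have NR0 : 0 < p.+1%:R :> R by [].
have MN0 : 0 < M * p.+1%:R by rewrite mulr_gt0// (lt_le_trans ltr01).
have lnMN : 0 <= ln (M * p.+1%:R).
  by rewrite ln_ge0// -[leLHS]mulr1 ler_pM.
have -> : ln n%:R = ln K%:R + 2 * ln p.+1%:R :> R.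
  by rewrite /n natrM natrX lnM ?posrE ?exprn_gt0 ?ltr0n// lnXn// mulr_natl.
have lnK : 0 <= ln K%:R :> R by rewrite ln_ge0// ler1n.
have lna : (2 * gamma * ln p.+1%:R - ln C') / 64 <= ln (ampl p M k.+1).
  have : ln ((p.+1 ^ 2)%N%:R `^ gamma) <= ln (C' * M ^+ q.+1 * p.+1%:R ^+ q.+1).
    rewrite ler_ln// posrE ?powR_gt0 ?ltr0n//.
    by rewrite !mulr_gt0// exprn_gt0// (lt_le_trans ltr01).
  rewrite -mulrA -exprMn ln_powR natrX lnXn// lnM ?posrE ?exprn_gt0// lnXn//.
  rewrite /ampl lnXn// => H.
  have : q.+1%:R * ln (M * p.+1%:R) <= 64 * ((2 ^ k.+1 - 1)%N%:R * ln (M * p.+1%:R)).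
    rewrite mulrA ler_wpM2r// -natrM ler_nat -qE.
    rewrite expnS; apply: arith; first by rewrite expn_gt0.
    by rewrite -(expnD 2 k 5) leq_exp2l.
  rewrite -[ln (M * p.+1%:R) *+ (2 ^ k.+1 - 1)]mulr_natl => H2.
  move: H; rewrite -[ln p.+1%:R *+ 2]mulr_natl -[ln (M * p.+1%:R) *+ q.+1]mulr_natl.
  move: (q.+1%:R * ln (M * p.+1%:R)) ((2 ^ k.+1 - 1)%N%:R * ln (M * p.+1%:R)) H2.
  by move=> u v; lra.
have : 0 <= D * (alpha / 4 * ln K%:R) by rewrite !mulr_ge0// ltW.
have := ler_wpM2l D0 lna.
by lra.
Qed.

End rate.

(** * The bound on the optimal orders *)

(** This excludes the value -oo and makes the final denominator positive. The exponent 0 is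
    admissible with L = 1, as [c] and sqrt n are at least 1. *)
Lemma gamma_flat_ge0 (R : realType) (ell c : nat -> option nat) :
  (forall n, (0 < n)%N -> (5%:R%:E <= ereal_of_onat R (ell n))%E) ->
  (forall n, (0 < n)%N -> (1 <= ereal_of_onat R (c n))%E) ->
  (0 <= gamma_flat R ell c)%E.
Proof.
move=> hell hc; apply: ereal_sup_ubound; exists 0 => //; split => //.
exists 1%N; split => //.
  apply: (@le_trans _ _ (ereal_of_onat R (ell 1%N))).
    by apply: le_trans (hell _ _) => //; rewrite lee_fin ler_nat.
  by apply: ereal_sup_ubound; exists 1%N.
exists 1 => // n n0; rewrite powRr0 mul1e -[(_ ^+ (2 ^ 1 - 1))%E]/(ereal_of_onat R (c n)).
have n1 : 1 <= n%:R `^ (1%:R / 2) :> R.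
  have n1 : 1 <= n%:R :> R by rewrite ler1n.
  have h : (0 : R) <= 1%:R / 2 by [].
  by have := ge0_ler_powR h _ _ n1; rewrite powR1 !nnegrE; apply.
rewrite -[leLHS]mule1; apply: lee_pmul => //; exact: hc.
Qed.

Local Open Scope ereal_scope.

Theorem theorem5p1 (R : realType) (d : nat) (alpha : R)
    (ell c : nat -> option nat)
    (hell : forall n : nat, (0 < n)%N -> 5%:R%:E <= ereal_of_onat R (ell n))
    (hc : forall n : nat, (0 < n)%N -> 1 <= ereal_of_onat R (c n))
    (ell_ndecr : forall m n : nat, (0 < m)%N -> (m <= n)%N ->
      ereal_of_onat R (ell m) <= ereal_of_onat R (ell n))
    (c_ndecr : forall m n : nat, (0 < m)%N -> (m <= n)%N ->
      ereal_of_onat R (c m) <= ereal_of_onat R (c n))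
    (hd : (0 < d)%N) (halpha : (0 < alpha)%R) :
  let U : set (ccube R d) := approx_ball ell c alpha in
  let iota : ccube R d -> ccube R d := idfun in
  let bound : \bar R :=
    (64 * alpha)%:E / (d%:R%:E * ((8 * alpha)%:E + gamma_flat R ell c)) in
  err_det U iota <= bound /\ err_MC U iota <= bound.
Proof.
case: d hd => // d _ U iota bound.
suff MC_le : err_MC U iota <= bound.
  by split => //; apply: le_trans (err_det_le_err_MC _ _) MC_le.
have g0 := gamma_flat_ge0 hell hc.
have a8 : (0 < 8 * alpha)%R by rewrite mulr_gt0.
apply: ge_ereal_sup => _ [beta [beta0 [C C0 eC]] <-].
move: beta0; rewrite [(0 <= beta)%R]le_eqVlt => /orP[/eqP<-|beta0].
  rewrite /bound mule_ge0 ?lee_fin ?mulr_ge0 ?(ltW halpha)//.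
  by rewrite inve_ge0 mule_ge0// adde_ge0// lee_fin ltW.
have bd0 : (0 < beta * d.+1%:R)%R by rewrite mulr_gt0.
(* A positive [beta] bounds all admissible exponents, so [gamma_flat] is finite here; when it is
   infinite, only [beta = 0] survives. *)
have : gamma_flat R ell c <= (64 * alpha / (beta * d.+1%:R) - 8 * alpha)%:E.
  apply: ge_ereal_sup => _ [gamma [gamma0 [L [L0 Lell [C' C'0 gC]]]] <-].
  rewrite lee_fin lerBrDl ler_pdivlMr// mulrC.
  exact: (rate_le hell hc ell_ndecr c_ndecr halpha (ltW beta0) C0 eC gamma0 L0 Lell C'0 gC).
rewrite /bound; case: (gamma_flat R ell c) g0 => [g| |]//; rewrite !lee_fin => g0.
rewrite lerBrDl ler_pdivlMr// => H.
have dg0 : (0 < d.+1%:R * (8 * alpha + g))%R by rewrite mulr_gt0// ltr_pwDl.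
rewrite -EFinD -EFinM inver gt_eqF// -EFinM lee_fin ler_pdivlMr//.
by rewrite mulrA mulrC.
Qed.
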